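(* For every positive integer $n$, the flat virtual braid group $FVB_n$ is linear.
   Context: The virtual braid group $VB_n$ is the group with generators $\sigma_1,\dots,\sigma_{n-1},\rho_1,\dots,\rho_{n-1}$ and defining relations: (R1) $\sigma_i\sigma_{i+1}\sigma_i=\sigma_{i+1}\sigma_i\sigma_{i+1}$ for $1\le i\le n-2$; (R2) $\sigma_i\sigma_j=\sigma_j\sigma_i$ for $|i-j|\ge 2$; (R3) $\rho_i\rho_{i+1}\rho_i=\rho_{i+1}\rho_i\rho_{i+1}$ for $1\le i\le n-2$; (R4) $\rho_i\rho_j=\rho_j\rho_i$ for $|i-j|\ge 2$; (R5) $\rho_i^2=1$ for $1\le i\le n-1$; (R6) $\sigma_i\rho_j=\rho_j\sigma_i$ for $|i-j|\ge 2$; (M) $\rho_i\rho_{i+1}\sigma_i=\sigma_{i+1}\rho_i\rho_{i+1}$ for $1\le i\le n-2$. The flat virtual braid group $FVB_n$ is the quotient of $VB_n$ by the relations $\sigma_i^2=1$ for $1\le i\le n-1$. A group is linear if it admits a faithful finite-dimensional linear representation over a field. *)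

(* Defs.v *)
(* Infinite groups are the [groupType]s of MathComp's monoid.v.  The
   congruences below are Prop-valued, so the quotient types are formed
   classically, through [asbool]. *)
From HB Require Import structures.
From mathcomp Require Import all_boot all_algebra.
From mathcomp Require Import boolp.

Set Implicit Arguments.
Unset Strict Implicit.
Unset Printing Implicit Defensive.

Local Open Scope group_scope.
Local Open Scope quotient_scope.

Section FreeGroup.
Variable X : choiceType.

(* (x, false) stands for x, (x, true) for its formal inverse. *)
Definition free_word := seq (X * bool).

Definition word_inv (w : free_word) : free_word :=
  rev [seq (p.1, ~~ p.2) | p <- w].

Inductive free_eq : free_word -> free_word -> Prop :=
| free_eq_cancel u v x b : free_eq (u ++ [:: (x, b); (x, ~~ b)] ++ v) (u ++ v)
| free_eq_refl u : free_eq u u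
| free_eq_sym u v : free_eq u v -> free_eq v u
| free_eq_trans u v w : free_eq u v -> free_eq v w -> free_eq u w.

Lemma free_eq_catl w u v : free_eq u v -> free_eq (w ++ u) (w ++ v).
Proof.
elim=> {u v} [u v x b|u|u v _|u v t _ + _]; last exact: free_eq_trans.
- by rewrite !(catA w); exact: free_eq_cancel.
- exact: free_eq_refl.
- exact: free_eq_sym.
Qed.

Lemma free_eq_catr w u v : free_eq u v -> free_eq (u ++ w) (v ++ w).
Proof.
elim=> {u v} [u v x b|u|u v _|u v t _ + _]; last exact: free_eq_trans.
- by rewrite -!catA; exact: free_eq_cancel.
- exact: free_eq_refl.
- exact: free_eq_sym.
Qed.

Lemma free_eq_cat u u' v v' :
  free_eq u u' -> free_eq v v' -> free_eq (u ++ v) (u' ++ v').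
Proof.
move=> uu' vv'; apply: (free_eq_trans (v := u' ++ v)).
  exact: free_eq_catr.
exact: free_eq_catl.
Qed.

Lemma word_invK : involutive word_inv.
Proof.
move=> w; rewrite /word_inv map_rev revK -map_comp -[RHS]map_id.
by apply: eq_map => -[x b] /=; rewrite negbK.
Qed.

Lemma free_eq_mulwV w : free_eq (w ++ word_inv w) [::].
Proof.
elim/last_ind: w => [|w [x b] IH]; first exact: free_eq_refl.
rewrite /word_inv map_rcons rev_rcons cat_rcons.
by apply: free_eq_trans IH; exact: free_eq_cancel.
Qed.

Lemma free_eq_mulVw w : free_eq (word_inv w ++ w) [::].
Proof. by have := free_eq_mulwV (word_inv w); rewrite word_invK. Qed.

Lemma free_eq_inv u v : free_eq u v -> free_eq (word_inv u) (word_inv v).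
Proof.
elim=> {u v} [u v x b|u|u v _|u v t _ + _]; last exact: free_eq_trans.
- by rewrite /word_inv !map_cat !rev_cat -!catA; case: b; exact: free_eq_cancel.
- exact: free_eq_refl.
- exact: free_eq_sym.
Qed.

Definition free_eqb : rel free_word := fun u v => `[< free_eq u v >].

Fact free_eqb_refl : reflexive free_eqb.
Proof. by move=> u; apply/asboolP/free_eq_refl. Qed.

Fact free_eqb_sym : symmetric free_eqb.
Proof. by move=> u v; apply/asboolP/asboolP; exact: free_eq_sym. Qed.

Fact free_eqb_trans : transitive free_eqb.
Proof.
by move=> v u w /asboolP uv /asboolP vw; apply/asboolP/(free_eq_trans uv).
Qed.

Canonical free_equiv :=
  EquivRel free_eqb free_eqb_refl free_eqb_sym free_eqb_trans.

Definition free_group : Type := {eq_quot free_equiv}.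

HB.instance Definition _ := Choice.on free_group.
HB.instance Definition _ := EqQuotient.on free_group.

Definition free_proj (w : free_word) : free_group := \pi w.

Lemma free_projE (u v : free_word) :
  free_proj u = free_proj v <-> free_eq u v.
Proof. by split=> [/eqmodP/asboolP|?]; last apply/eqmodP/asboolP. Qed.

Lemma free_proj_repr (a : free_group) : free_proj (repr a) = a.
Proof. exact: reprK. Qed.

Definition free_one : free_group := free_proj [::].
Definition free_mul (a b : free_group) : free_group := free_proj (repr a ++ repr b).
Definition free_inv (a : free_group) : free_group := free_proj (word_inv (repr a)).

Lemma free_repr_proj u : free_eq (repr (free_proj u)) u.
Proof. by apply/free_projE; rewrite free_proj_repr. Qed.

Fact free_mul_proj u v : free_mul (free_proj u) (free_proj v) = free_proj (u ++ v).
Proof. by apply/free_projE/free_eq_cat; exact: free_repr_proj. Qed.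

Lemma free_inv_proj u : free_inv (free_proj u) = free_proj (word_inv u).
Proof. by apply/free_projE/free_eq_inv; exact: free_repr_proj. Qed.

Fact free_mulA : associative free_mul.
Proof.
move=> a b c; rewrite -[a]free_proj_repr -[b]free_proj_repr -[c]free_proj_repr.
by rewrite !free_mul_proj catA.
Qed.

Fact free_mul1 : left_id free_one free_mul.
Proof. by move=> a; rewrite -[a]free_proj_repr free_mul_proj. Qed.

Fact free_mulr1 : right_id free_one free_mul.
Proof. by move=> a; rewrite -[a]free_proj_repr free_mul_proj cats0. Qed.

Fact free_mulV : left_inverse free_one free_inv free_mul.
Proof.
move=> a; rewrite -[a]free_proj_repr free_inv_proj free_mul_proj.
exact/free_projE/free_eq_mulVw.
Qed.

Fact free_mulrV : right_inverse free_one free_inv free_mul.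
Proof.
move=> a; rewrite -[a]free_proj_repr free_inv_proj free_mul_proj.
exact/free_projE/free_eq_mulwV.
Qed.

HB.instance Definition _ := isGroup.Build free_group
  free_mulA free_mul1 free_mulr1 free_mulV free_mulrV.

Definition free_gen (x : X) : free_group := free_proj [:: (x, false)].

End FreeGroup.

(* [quot_group] is the quotient of G by the smallest congruence containing R,
   i.e. by the normal closure of the elements x * y^-1 with R x y. *)

Section QuotientByRelations.
Variables (G : groupType) (R : G -> G -> Prop).

Inductive rel_cong : G -> G -> Prop :=
| rel_cong_base x y : R x y -> rel_cong x y
| rel_cong_refl x : rel_cong x x
| rel_cong_sym x y : rel_cong x y -> rel_cong y x
| rel_cong_trans x y z : rel_cong x y -> rel_cong y z -> rel_cong x z
| rel_cong_mul x x' y y' :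
    rel_cong x x' -> rel_cong y y' -> rel_cong (x * y) (x' * y').

Lemma rel_cong_inv x y : rel_cong x y -> rel_cong x^-1 y^-1.
Proof.
move=> /rel_cong_sym yx.
have := rel_cong_mul (rel_cong_mul (rel_cong_refl x^-1) yx)
                     (rel_cong_refl y^-1).
by rewrite mulgK mulVg mul1g.
Qed.

Definition rel_congb : rel G := fun x y => `[< rel_cong x y >].

Fact rel_congb_refl : reflexive rel_congb.
Proof. by move=> x; apply/asboolP/rel_cong_refl. Qed.

Fact rel_congb_sym : symmetric rel_congb.
Proof. by move=> x y; apply/asboolP/asboolP; exact: rel_cong_sym. Qed.

Fact rel_congb_trans : transitive rel_congb.
Proof.
by move=> y x z /asboolP xy /asboolP yz; apply/asboolP/(rel_cong_trans xy).
Qed.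

Canonical rel_equiv :=
  EquivRel rel_congb rel_congb_refl rel_congb_sym rel_congb_trans.

Definition quot_group : Type := {eq_quot rel_equiv}.

HB.instance Definition _ := Choice.on quot_group.
HB.instance Definition _ := EqQuotient.on quot_group.

Definition quot_proj (x : G) : quot_group := \pi x.

Lemma quot_projE x y : quot_proj x = quot_proj y <-> rel_cong x y.
Proof. by split=> [/eqmodP/asboolP|?]; last apply/eqmodP/asboolP. Qed.

Lemma quot_proj_repr (a : quot_group) : quot_proj (repr a) = a.
Proof. exact: reprK. Qed.

Definition quot_one : quot_group := quot_proj 1.
Definition quot_mul (a b : quot_group) : quot_group :=
  quot_proj (repr a * repr b).
Definition quot_inv (a : quot_group) : quot_group := quot_proj (repr a)^-1.

Lemma quot_repr_proj x : rel_cong (repr (quot_proj x)) x.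
Proof. by apply/quot_projE; rewrite quot_proj_repr. Qed.

Fact quot_mul_proj x y : quot_mul (quot_proj x) (quot_proj y) = quot_proj (x * y).
Proof. by apply/quot_projE/rel_cong_mul; exact: quot_repr_proj. Qed.

Fact quot_inv_proj x : quot_inv (quot_proj x) = quot_proj x^-1.
Proof. by apply/quot_projE/rel_cong_inv; exact: quot_repr_proj. Qed.

Fact quot_mulA : associative quot_mul.
Proof.
move=> a b c; rewrite -[a]quot_proj_repr -[b]quot_proj_repr -[c]quot_proj_repr.
by rewrite !quot_mul_proj mulgA.
Qed.

Fact quot_mul1 : left_id quot_one quot_mul.
Proof. by move=> a; rewrite -[a]quot_proj_repr quot_mul_proj mul1g. Qed.

Fact quot_mulr1 : right_id quot_one quot_mul.
Proof. by move=> a; rewrite -[a]quot_proj_repr quot_mul_proj mulg1. Qed.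

Fact quot_mulV : left_inverse quot_one quot_inv quot_mul.
Proof.
by move=> a; rewrite -[a]quot_proj_repr quot_inv_proj quot_mul_proj mulVg.
Qed.

Fact quot_mulrV : right_inverse quot_one quot_inv quot_mul.
Proof.
by move=> a; rewrite -[a]quot_proj_repr quot_inv_proj quot_mul_proj mulgV.
Qed.

HB.instance Definition _ := isGroup.Build quot_group
  quot_mulA quot_mul1 quot_mulr1 quot_mulV quot_mulrV.

Fact quot_projM : {morph quot_proj : x y / x * y}.
Proof. by move=> x y; rewrite -quot_mul_proj. Qed.

End QuotientByRelations.

(* Indices start at 0: for i : 'I_n.-1, [inl i] is
   sigma_(i+1) and [inr i] is rho_(i+1). *)

Definition vb_gen (n : nat) : choiceType := ('I_n.-1 + 'I_n.-1)%type.

Definition far (i j : nat) : bool := (i.+2 <= j)%N || (j.+2 <= i)%N.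

Section VirtualBraid.
Variable n : nat.

Definition fsigma (i : 'I_n.-1) : free_group (vb_gen n) :=
  free_gen (inl i : vb_gen n).
Definition frho (i : 'I_n.-1) : free_group (vb_gen n) :=
  free_gen (inr i : vb_gen n).

Inductive vb_rel : free_group (vb_gen n) -> free_group (vb_gen n) -> Prop :=
| vb_R1 (i j : 'I_n.-1) : j = i.+1 :> nat ->
    vb_rel (fsigma i * fsigma j * fsigma i) (fsigma j * fsigma i * fsigma j)
| vb_R2 (i j : 'I_n.-1) : far i j ->
    vb_rel (fsigma i * fsigma j) (fsigma j * fsigma i)
| vb_R3 (i j : 'I_n.-1) : j = i.+1 :> nat ->
    vb_rel (frho i * frho j * frho i) (frho j * frho i * frho j)
| vb_R4 (i j : 'I_n.-1) : far i j ->
    vb_rel (frho i * frho j) (frho j * frho i)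
| vb_R5 (i : 'I_n.-1) :
    vb_rel (frho i ^+ 2) 1
| vb_R6 (i j : 'I_n.-1) : far i j ->
    vb_rel (fsigma i * frho j) (frho j * fsigma i)
| vb_M (i j : 'I_n.-1) : j = i.+1 :> nat ->
    vb_rel (frho i * frho j * fsigma i) (fsigma j * frho i * frho j).

Definition VB : groupType := quot_group vb_rel.

Definition vb_sigma (i : 'I_n.-1) : VB := quot_proj vb_rel (fsigma i).

Inductive fvb_rel : VB -> VB -> Prop :=
| fvb_sigma2 (i : 'I_n.-1) : fvb_rel (vb_sigma i ^+ 2) 1.

Definition FVB : groupType := quot_group fvb_rel.

End VirtualBraid.

(* [mx_representation] of MathComp is limited to finite groups.  The two
   morphism laws force every r x to be invertible. *)

Definition group_mx_repr (G : groupType) (F : fieldType) (d : nat)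
    (r : G -> 'M[F]_d) : Prop :=
  r 1 = 1%:M%R /\ {morph r : x y / x * y >-> (x *m y)%R}.

Definition linear_group (G : groupType) : Prop :=
  exists (F : fieldType) (d : nat) (r : G -> 'M[F]_d),
    group_mx_repr r /\ injective r.

(* Main.v *)
(* Let W be the subgroup of FVB_n generated by the conjugates x_(i,j) of the
   sigma's by the rho's.  The x_(i,j), i <> j, are permuted by the rho's through
   their indices, they are involutions, x_(i,j) and x_(k,l) commute for distinct
   i, j, k, l, and x_(i,j), x_(j,k) satisfy the braid relation.  Thus W is a
   quotient of a Coxeter group with exponents 2, 3, infinity, and FVB_n is the
   product of W and the group generated by the rho's, a quotient of S_n.  Let
   sigma_i act on n x n matrices as the Tits reflection in the position
   (i,i+1), and the rho's by permuting rows and columns simultaneously.  The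
   diagonal positions are fixed by W and detect the permutation; the
   off-diagonal ones carry the Tits representation of the Coxeter group.
   Tits' argument, that w alpha_i is nonnegative whenever w s_i is longer than
   w, only needs the relations of W and the parity of lengths, and it shows that
   a word acting trivially is trivial in W. *)
Require Import Defs.
From HB Require Import structures.
From mathcomp Require Import all_boot all_order all_algebra.
From mathcomp Require Import boolp zify ring.

Set Implicit Arguments.
Unset Strict Implicit.
Unset Printing Implicit Defensive.

Import GRing.Theory Num.Theory.
Local Open Scope group_scope.

(** * Group actions and presentations *)

Definition is_action (G : groupType) (V : Type) (act : G -> V -> V) : Prop :=
  act 1 =1 id /\ forall x y v, act (x * y) v = act x (act y v).

Section WordProducts.
Variables (G : groupType) (I : Type) (s : I -> G).

Definition gprod (w : seq I) : G := foldr (fun i g => s i * g) 1 w.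

Lemma gprod_cat u v : gprod (u ++ v) = gprod u * gprod v.
Proof. by elim: u => [|i u IH] /=; rewrite ?mul1g // IH mulgA. Qed.

Lemma gprod_rcons u i : gprod (rcons u i) = gprod u * s i.
Proof. by rewrite -cats1 gprod_cat /= mulg1. Qed.

End WordProducts.

Section FreeAction.
Variables (X : choiceType) (V : Type) (f : X -> V -> V).
Hypothesis fK : forall x, involutive (f x).

(** The sign of a letter is ignored: each [f x] is an involution, so a generator and its formal
    inverse act alike. *)
Definition word_act (w : free_word X) (v : V) : V :=
  foldr (fun p => f p.1) v w.

Lemma word_act_free_eq u v : free_eq u v -> word_act u =1 word_act v.
Proof.
elim=> {u v} [u v x b|u|u v _ IH|u v t _ IH1 _ IH2] y //.
- by rewrite /word_act !foldr_cat /= fK.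
- by rewrite IH1 IH2.
Qed.

Definition free_act (g : free_group X) : V -> V := word_act (repr g).

Lemma free_act_proj w : free_act (free_proj w) =1 word_act w.
Proof. exact/word_act_free_eq/free_repr_proj. Qed.

Lemma free_act_gen x : free_act (free_gen x) =1 f x.
Proof. exact: free_act_proj. Qed.

Lemma free_act_action : is_action free_act.
Proof.
split=> [v|x y v]; first exact: free_act_proj.
by rewrite [LHS]free_act_proj /word_act foldr_cat.
Qed.

End FreeAction.

Section QuotientAction.
Variables (G : groupType) (R : G -> G -> Prop) (V : Type) (act : G -> V -> V).
Hypothesis actP : is_action act.
Hypothesis actR : forall x y, R x y -> act x =1 act y.

Lemma rel_cong_act x y : rel_cong R x y -> act x =1 act y.
Proof.
case: actP => _ actM; elim=> {x y} [x y /actR //|//|x y _ IH v|x y z _ IH1 _ IH2 v|].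
- by rewrite IH.
- by rewrite IH1 IH2.
- by move=> x x' y y' _ IH1 _ IH2 v; rewrite !actM IH2 IH1.
Qed.

Definition quot_act (g : quot_group R) : V -> V := act (repr g).

Lemma quot_act_proj x : quot_act (quot_proj R x) =1 act x.
Proof. exact/rel_cong_act/quot_repr_proj. Qed.

Lemma quot_act_action : is_action quot_act.
Proof.
have [act1 actM] := actP; split=> [v|x y v]; first by rewrite [LHS]quot_act_proj act1.
by rewrite [LHS]quot_act_proj actM.
Qed.

End QuotientAction.

(** * The relations of $FVB_n$ and actions defined on generators *)

Section FlatVirtualBraid.
Variable n : nat.

Definition fvb_proj (x : free_group (vb_gen n)) : FVB n :=
  quot_proj (@fvb_rel n) (quot_proj (@vb_rel n) x).

Lemma fvb_projM : {morph fvb_proj : x y / x * y}.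
Proof. by move=> x y; rewrite /fvb_proj (quot_projM (@vb_rel n)) quot_projM. Qed.

Lemma fvb_proj_rel x y : vb_rel x y -> fvb_proj x = fvb_proj y.
Proof. by move=> xy; congr quot_proj; apply/quot_projE/rel_cong_base. Qed.

Definition fvb_sigma (i : 'I_n.-1) : FVB n := fvb_proj (fsigma i).
Definition fvb_rho (i : 'I_n.-1) : FVB n := fvb_proj (frho i).

Lemma fvb_sigmaK i : fvb_sigma i * fvb_sigma i = 1.
Proof. by rewrite -[LHS]quot_projM; exact/quot_projE/rel_cong_base/(fvb_sigma2 i). Qed.

Lemma fvb_rhoK i : fvb_rho i * fvb_rho i = 1.
Proof. by rewrite -fvb_projM; exact: (fvb_proj_rel (vb_R5 i)). Qed.

Lemma fvb_sigma_braid (i j : 'I_n.-1) : j = i.+1 :> nat ->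
  fvb_sigma i * fvb_sigma j * fvb_sigma i = fvb_sigma j * fvb_sigma i * fvb_sigma j.
Proof. by move=> /vb_R1/fvb_proj_rel; rewrite !fvb_projM. Qed.

Lemma fvb_sigmaC (i j : 'I_n.-1) : far i j ->
  fvb_sigma i * fvb_sigma j = fvb_sigma j * fvb_sigma i.
Proof. by move=> /vb_R2/fvb_proj_rel; rewrite !fvb_projM. Qed.

Lemma fvb_rho_braid (i j : 'I_n.-1) : j = i.+1 :> nat ->
  fvb_rho i * fvb_rho j * fvb_rho i = fvb_rho j * fvb_rho i * fvb_rho j.
Proof. by move=> /vb_R3/fvb_proj_rel; rewrite !fvb_projM. Qed.

Lemma fvb_rhoC (i j : 'I_n.-1) : far i j ->
  fvb_rho i * fvb_rho j = fvb_rho j * fvb_rho i.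
Proof. by move=> /vb_R4/fvb_proj_rel; rewrite !fvb_projM. Qed.

Lemma fvb_sigma_rhoC (i j : 'I_n.-1) : far i j ->
  fvb_sigma i * fvb_rho j = fvb_rho j * fvb_sigma i.
Proof. by move=> /vb_R6/fvb_proj_rel; rewrite !fvb_projM. Qed.

Lemma fvb_mixed (i j : 'I_n.-1) : j = i.+1 :> nat ->
  fvb_rho i * fvb_rho j * fvb_sigma i = fvb_sigma j * fvb_rho i * fvb_rho j.
Proof. by move=> /vb_M/fvb_proj_rel; rewrite !fvb_projM. Qed.

Definition fvb_gen (x : vb_gen n) : FVB n :=
  match x with inl i => fvb_sigma i | inr i => fvb_rho i end.

Lemma fvb_genK x : fvb_gen x * fvb_gen x = 1.
Proof. by case: x => i; [exact: fvb_sigmaK | exact: fvb_rhoK]. Qed.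

(** All generators are involutions, so words without inverse letters reach every element. *)
Lemma fvb_generated (g : FVB n) : exists w, g = gprod fvb_gen w.
Proof.
have [x <-] : exists x, fvb_proj x = g.
  by exists (repr (repr g)); rewrite /fvb_proj !quot_proj_repr.
rewrite -[x]free_proj_repr; elim: (repr x) => [|[y b] w [u IH]]; first by exists [::].
exists (y :: u); rewrite /= -IH.
have cons_proj v : free_proj ((y, b) :: v) = free_proj [:: (y, b)] * free_proj v.
  by rewrite -[RHS]/(free_mul _ _) free_mul_proj.
rewrite cons_proj fvb_projM; congr (_ * _).
have Egen : fvb_proj (free_gen y) = fvb_gen y by case: y {cons_proj}.
case: b cons_proj => cons_proj; last exact: Egen.
apply: (mulIg (fvb_gen y)); rewrite fvb_genK -Egen -fvb_projM /free_gen -cons_proj.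
congr fvb_proj; apply/free_projE; exact: (free_eq_cancel [::] [::] y true).
Qed.

Section Action.
Variables (V : Type) (S R : 'I_n.-1 -> V -> V).
Hypotheses (SK : forall i, involutive (S i)) (RK : forall i, involutive (R i)).
Hypothesis Sbraid : forall i j : 'I_n.-1, j = i.+1 :> nat ->
  S i \o S j \o S i =1 S j \o S i \o S j.
Hypothesis SC : forall i j : 'I_n.-1, far i j -> S i \o S j =1 S j \o S i.
Hypothesis Rbraid : forall i j : 'I_n.-1, j = i.+1 :> nat ->
  R i \o R j \o R i =1 R j \o R i \o R j.
Hypothesis RC : forall i j : 'I_n.-1, far i j -> R i \o R j =1 R j \o R i.
Hypothesis SRC : forall i j : 'I_n.-1, far i j -> S i \o R j =1 R j \o S i.
Hypothesis RS : forall i j : 'I_n.-1, j = i.+1 :> nat ->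
  R i \o R j \o S i =1 S j \o R i \o R j.

(** The universal property of the presentation, applied below to parities, to permutations of
    indices and to matrices. *)
Lemma fvb_action : exists act : FVB n -> V -> V,
  [/\ is_action act, forall i, act (fvb_sigma i) =1 S i
    & forall i, act (fvb_rho i) =1 R i].
Proof.
pose f (x : vb_gen n) := match x with inl i => S i | inr i => R i end.
have fK x : involutive (f x) by case: x.
have [a1 aM] := free_act_action fK.
have fS i : free_act f (fsigma i) =1 S i by exact: free_act_gen.
have fR i : free_act f (frho i) =1 R i by exact: free_act_gen.
have aR x y : vb_rel x y -> free_act f x =1 free_act f y.
  case=> [i j ij|i j ij|i j ij|i j ij|i|i j ij|i j ij] v;
    rewrite ?expgS ?expg0 ?mulg1 ?a1 !aM !(fS, fR).
  - exact: Sbraid.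
  - exact: SC.
  - exact: Rbraid.
  - exact: RC.
  - exact: RK.
  - exact: SRC.
  - exact: RS.
have qP := quot_act_action (free_act_action fK) aR.
have qE := quot_act_proj (free_act_action fK) aR.
have [q1 qM] := qP.
have bR x y : fvb_rel x y -> quot_act (free_act f) x =1 quot_act (free_act f) y.
  by case=> i v; rewrite expgS expg1 q1 qM /vb_sigma !qE !fS SK.
exists (quot_act (quot_act (free_act f))); split.
- exact: quot_act_action qP bR.
- by move=> i v; rewrite (quot_act_proj qP bR) /vb_sigma qE fS.
- by move=> i v; rewrite (quot_act_proj qP bR) qE fR.
Qed.

End Action.

End FlatVirtualBraid.

(** * The Tits representation *)

Section CoxeterLength.
Variables (G : groupType) (I : Type) (s : I -> G).
Hypothesis sK : forall i, s i * s i = 1.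
Hypothesis parity : forall u v, gprod s u = gprod s v -> odd (size u) = odd (size v).

Let has_word (g : G) (k : nat) : bool := `[< exists2 u, size u = k & g = gprod s u >].

Let has_word_gprod w : exists k, has_word (gprod s w) k.
Proof. by exists (size w); apply/asboolP; exists w. Qed.

Definition wlen (w : seq I) : nat := ex_minn (has_word_gprod w).

Lemma wlen_min u w : gprod s u = gprod s w -> (wlen w <= size u)%N.
Proof.
move=> uw; rewrite /wlen; case: ex_minnP => k _; apply.
by apply/asboolP; exists u.
Qed.

Lemma wlen_word w : exists2 u, size u = wlen w & gprod s u = gprod s w.
Proof. by rewrite /wlen; case: ex_minnP => k /asboolP[u uk ->] _; exists u. Qed.

Lemma wlen_eq u w : gprod s u = gprod s w -> wlen u = wlen w.
Proof.
move=> uw; have [u' su' u'u] := wlen_word u; have [w' sw' w'w] := wlen_word w.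
apply/eqP; rewrite eqn_leq -{1}sw' wlen_min ?w'w //=.
by rewrite -su' wlen_min ?u'u.
Qed.

Lemma odd_wlen w : odd (wlen w) = odd (size w).
Proof. by have [u <- /parity] := wlen_word w. Qed.

Lemma wlen_cat u w : (wlen (u ++ w) <= wlen u + size w)%N.
Proof.
have [u' <- u'u] := wlen_word u; rewrite -size_cat; apply: wlen_min.
by rewrite !gprod_cat u'u.
Qed.

Definition descent (w : seq I) (i : I) : bool := (wlen (rcons w i) < wlen w)%N.

(** One more letter adds at most one to the length; without a drop, parity excludes equality. *)
Lemma wlen_ascent w i : ~~ descent w i -> wlen (rcons w i) = (wlen w).+1.
Proof.
rewrite /descent => ndes; have := wlen_cat w [:: i]; rewrite cats1 /=.
have := odd_wlen (rcons w i); rewrite size_rcons /= -odd_wlen; lia.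
Qed.

(** The witness is [rcons w i]: a second letter [i] cancels the first, and since it can add at most
    one to the length, the drop is exactly one. *)
Lemma descentP w i : descent w i -> exists u,
  [/\ gprod s (rcons u i) = gprod s w, (wlen u).+1 = wlen w & ~~ descent u i].
Proof.
move=> wi; exists (rcons w i).
have E : gprod s (rcons (rcons w i) i) = gprod s w.
  by rewrite !gprod_rcons -mulgA sK mulg1.
have := wlen_cat (rcons w i) [:: i]; rewrite cats1 /= /descent (wlen_eq E).
by move: wi; rewrite /descent; split=> //; lia.
Qed.

(** The last letter of a shortest word for [gprod s w] is a descent. *)
Lemma wlen_gt0_descent w : (0 < wlen w)%N -> exists i, descent w i.
Proof.
have [u su uw] := wlen_word w; case/lastP: u su uw => [<- //|u i su uw _].
exists i; rewrite /descent -su size_rcons ltnS; apply: wlen_min.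
by rewrite gprod_rcons -uw gprod_rcons -mulgA sK mulg1.
Qed.

End CoxeterLength.

(** * Tits' positivity argument *)

Section TitsRepresentation.
Variables (G : groupType) (I : eqType) (s : I -> G) (c : I -> I -> nat).
Hypothesis sK : forall i, s i * s i = 1.
Hypothesis parity : forall u v, gprod s u = gprod s v -> odd (size u) = odd (size v).
Hypothesis c_sym : forall i j, c i j = c j i.
Hypothesis s_comm : forall i j, i != j -> c i j = 0%N -> s i * s j = s j * s i.
Hypothesis s_braid : forall i j, i != j -> c i j = 1%N ->
  s i * s j * s i = s j * s i * s j.

(** The [alpha i] are the simple roots, [C] is a cone of nonnegative vectors, and [c i j] is minus
    the off-diagonal Cartan entry. *)
Variables (V : zmodType) (act : G -> V -> V) (alpha : I -> V) (C : V -> Prop).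
Hypothesis actP : is_action act.
Hypothesis actD : forall g, {morph act g : u v / (u + v)%R}.
Hypothesis act_refl : forall i, act (s i) (alpha i) = (- alpha i)%R.
Hypothesis act_simple : forall i j, i != j ->
  act (s i) (alpha j) = (alpha j + alpha i *+ c i j)%R.
Hypothesis C0 : C 0%R.
Hypothesis CD : forall u v, C u -> C v -> C (u + v)%R.
Hypothesis C_simple : forall i, C (alpha i).
Hypothesis C_neg : forall i, ~ C (- alpha i)%R.

Notation ract w := (act (gprod s w)).
Notation wlen := (wlen s).
Notation descent := (descent s).

Lemma act0 g : act g 0%R = 0%R.
Proof. by apply: (@addrI _ (act g 0%R)); rewrite -actD !addr0. Qed.

Lemma actMn g v k : act g (v *+ k)%R = (act g v *+ k)%R.
Proof. by elim: k => [|k IH]; rewrite ?act0 // !mulrS actD IH. Qed.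

Lemma actN g v : act g (- v)%R = (- act g v)%R.
Proof. by apply: (@addrI _ (act g v)); rewrite -actD !subrr act0. Qed.

Lemma C_Mn v k : C v -> C (v *+ k)%R.
Proof. by move=> Cv; elim: k => [|k IH]; rewrite ?mulrS //; apply: CD. Qed.

Lemma ract_rcons w i v : ract (rcons w i) v = ract w (act (s i) v).
Proof. by case: actP => _ actM; rewrite gprod_rcons actM. Qed.

(* Rank two, infinite order: s_j sends a alpha_i + b alpha_j to
   a alpha_i + (c a - b) alpha_j, and c a - b >= a as soon as c >= 2 and
   a >= b, so the inequality between the coefficients propagates while the
   letters i and j are stripped alternately from the right of the word. *)
Lemma pos_dihedral i j n : i != j -> (2 <= c i j)%N ->
  (forall w k, (wlen w <= n)%N -> ~~ descent w k -> C (ract w (alpha k))) ->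
  forall w a b, (wlen w <= n)%N -> ~~ descent w i -> (b <= a)%N ->
    C (ract w (alpha i *+ a + alpha j *+ b)%R).
Proof.
move=> ij cij IH w; move: {2}(wlen w) (leqnn (wlen w)) => k.
elim: k i j ij cij w => [|k IHk] i j ij cij w wk a b wn wi ba.
all: have Ci : C (ract w (alpha i)) by exact: IH.
all: have [wj|wj] := boolP (descent w j);
  last by rewrite actD !actMn; apply: CD; apply: C_Mn => //; exact: IH.
all: have [u [uw lu uj]] := descentP sK wj.
  by lia.
(* The subtraction in [nat] is exact, because [b <= a] and [c i j >= 2]. *)
have -> : ract w (alpha i *+ a + alpha j *+ b)%R =
          ract u (alpha j *+ (c i j * a - b) + alpha i *+ a)%R.
  rewrite -uw ract_rcons; congr (ract u _).
  rewrite actD !actMn act_refl act_simple 1?eq_sym // c_sym mulrnDl.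
  rewrite -mulrnA mulNrn -addrA addrC mulrnBr //.
  by nia.
have ji : j != i by rewrite eq_sym.
have cji : (2 <= c j i)%N by rewrite c_sym.
by apply: IHk => //; [lia | lia | nia].
Qed.

(** Induction on the length: a descent [j] of [w] gives w = u s_j, hence w alpha_i = u (alpha_i + c
    alpha_j), and the value of c decides how to continue. *)
Lemma pos_of_ascent w i : ~~ descent w i -> C (ract w (alpha i)).
Proof.
move: {2}(wlen w) (leqnn (wlen w)) => n.
elim: n w i => [|n IH] w i wn wi.
  have [u] := wlen_word s w; have -> : wlen w = 0%N by lia.
  by case: u => // _ <- /=; case: actP => -> _.
have [/eqP l0|lpos] := boolP (wlen w == 0%N); first by apply: IH; rewrite // l0.
have [j wj] : exists j, descent w j.
  by apply: (wlen_gt0_descent sK); rewrite lt0n.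
have ij : i != j by apply: contraNneq wi => ->.
have ji : j != i by rewrite eq_sym.
have [u [uw lu uj]] := descentP sK wj.
have un : (wlen u <= n)%N by lia.
have lwi := wlen_ascent parity wi.
have -> : ract w (alpha i) = ract u (alpha i + alpha j *+ c j i)%R.
  by rewrite -uw ract_rcons act_simple.
have short v : gprod s v = gprod s (rcons w i) -> ~ (wlen v <= wlen w)%N.
  by move=> /wlen_eq ->; rewrite lwi ltnn.
case Ecij: (c j i) => [|[|d]].
(* If [i] were a descent of [u], then w s_i = u s_i s_j would be too short. *)
- rewrite addr0; apply: IH => //; apply/negP => ui.
  apply: (short (rcons u i ++ [:: j])).
    rewrite !cats1 !gprod_rcons -uw !gprod_rcons -!mulgA; congr (_ * _).
    by apply: s_comm; rewrite // c_sym.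
  by have := wlen_cat s (rcons u i) [:: j]; move: ui; rewrite /descent /=; lia.
(* If u = v s_i with [v] shorter, then u (alpha_i + alpha_j) = v alpha_j. A descent [j] of [v] would
   make w s_i = v s_j s_i s_j too short. *)
- have Cj := IH u j un uj.
  rewrite actD; have [ui|ui] := boolP (descent u i); last by apply: CD => //; exact: IH.
  have [v [vu lv vi]] := descentP sK ui.
  rewrite -actD -vu ract_rcons actD act_refl act_simple // c_sym Ecij.
  rewrite addrC addrK; apply: IH; first by lia.
  apply/negP => vj; apply: (short (rcons v j ++ [:: i; j])).
    rewrite gprod_cat !gprod_rcons /= -uw !gprod_rcons -vu gprod_rcons.
    by rewrite -!mulgA mulg1; congr (_ * _); rewrite !mulgA s_braid.
  by have := wlen_cat s (rcons v j) [:: i; j]; move: vj; rewrite /descent /=; lia.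
(* No relation between s_i and s_j: the coefficients are c >= 1, with the larger one on the ascent
   [j] of [u]. *)
- have := @pos_dihedral j i n ji _ IH u (c j i) 1 un uj _; rewrite Ecij => /(_ isT isT).
  by rewrite addrC.
Qed.

(** Otherwise w = u s_i with u alpha_i in [C]; but w alpha_i = alpha_i gives u alpha_i = - alpha_i,
    which is not in [C]. *)
Theorem tits_faithful w : ract w =1 id -> gprod s w = 1.
Proof.
move=> wid; have [/eqP l0|] := boolP (wlen w == 0%N).
  by have [u + <-] := wlen_word s w; rewrite l0; case: u.
rewrite -lt0n => /(wlen_gt0_descent sK)[i wi].
have [u [uw _ /pos_of_ascent]] := descentP sK wi.
have : ract (rcons u i) (alpha i) = alpha i by rewrite uw wid.
by rewrite ract_rcons act_refl actN => /(congr1 GRing.opp); rewrite opprK => -> /C_neg.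
Qed.

End TitsRepresentation.

(** * The subgroup generated by the rho's *)

(** The transposition of [i] and [i.+1], on all of [nat]. *)
Definition adj (i x : nat) : nat :=
  if x == i then i.+1 else if x == i.+1 then i else x.

Lemma adjK i : involutive (adj i).
Proof. by move=> x; rewrite /adj; repeat case: eqP; lia. Qed.

Lemma adj_braid i : adj i \o adj i.+1 \o adj i =1 adj i.+1 \o adj i \o adj i.+1.
Proof. by move=> x; rewrite /= /adj; repeat case: eqP; lia. Qed.

Lemma adjC i j : far i j -> adj i \o adj j =1 adj j \o adj i.
Proof. by rewrite /far => ij x; rewrite /= /adj; repeat case: eqP; lia. Qed.

Section Rho.
Variables (G : groupType) (m : nat) (sg rh : nat -> G) (p : G -> nat -> nat).
Hypothesis rhK : forall i, (i < m)%N -> rh i * rh i = 1.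
Hypothesis rh_braid : forall i, (i.+1 < m)%N ->
  rh i * rh i.+1 * rh i = rh i.+1 * rh i * rh i.+1.
Hypothesis rhC : forall i j, (i < m)%N -> (j < m)%N -> far i j ->
  rh i * rh j = rh j * rh i.
Hypothesis sgK : forall i, (i < m)%N -> sg i * sg i = 1.
Hypothesis sg_braid : forall i, (i.+1 < m)%N ->
  sg i * sg i.+1 * sg i = sg i.+1 * sg i * sg i.+1.
Hypothesis sgC : forall i j, (i < m)%N -> (j < m)%N -> far i j ->
  sg i * sg j = sg j * sg i.
Hypothesis sg_rhC : forall i j, (i < m)%N -> (j < m)%N -> far i j ->
  sg i * rh j = rh j * sg i.
Hypothesis rh_sg : forall i, (i.+1 < m)%N ->
  rh i * rh i.+1 * sg i = sg i.+1 * rh i * rh i.+1.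
Hypothesis pP : is_action p.
Hypothesis p_rh : forall i, (i < m)%N -> p (rh i) =1 adj i.

Let p1 x : p 1 x = x. Proof. by case: pP. Qed.
Let pM g h x : p (g * h) x = p g (p h x). Proof. by case: pP. Qed.
Let pVK g x : p g^-1 (p g x) = x. Proof. by rewrite -pM mulVg p1. Qed.
Let pKV g x : p g (p g^-1 x) = x. Proof. by rewrite -pM mulgV p1. Qed.

(** Words without inverses already form a subgroup, the [rh i] being involutions; it corresponds to
    the permutations of k, ..., m. *)
Definition rho_from (k : nat) (g : G) : Prop :=
  exists2 w, all (fun i => k <= i < m)%N w & g = gprod rh w.

Lemma rho_from1 k : rho_from k 1.
Proof. by exists [::]. Qed.

Lemma rho_fromM k g h : rho_from k g -> rho_from k h -> rho_from k (g * h).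
Proof.
by move=> [u ku ->] [v kv ->]; exists (u ++ v); rewrite ?all_cat ?ku // gprod_cat.
Qed.

Lemma rho_from_rh k i : (k <= i < m)%N -> rho_from k (rh i).
Proof. by move=> ki; exists [:: i]; rewrite /= ?ki // mulg1. Qed.

Lemma rho_from_ind k (Q : G -> Prop) : Q 1 ->
  (forall i g, (k <= i < m)%N -> rho_from k g -> Q g -> Q (rh i * g)) ->
  forall g, rho_from k g -> Q g.
Proof.
move=> Q1 QM g [w kw ->]; elim: w kw => //= i w IH /andP[ki kw].
by apply: QM => //; [exists w | exact: IH].
Qed.

Lemma rho_fromV k g : rho_from k g -> rho_from k g^-1.
Proof.
elim/rho_from_ind => [|i h ki _ IH]; first by rewrite invg1; exact: rho_from1.
rewrite invgM; apply: rho_fromM => //.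
have /andP[_ im] := ki; suff -> : (rh i)^-1 = rh i by exact: rho_from_rh.
by apply: (mulIg (rh i)); rewrite mulVg rhK.
Qed.

Lemma rho_fromW k k' g : (k' <= k)%N -> rho_from k g -> rho_from k' g.
Proof.
move=> kk' [w kw ->]; exists w => //; apply: sub_all kw => i /andP[ki ->].
by rewrite (leq_trans kk').
Qed.

Lemma rho_from_fix k g x : rho_from k g -> (x < k)%N -> p g x = x.
Proof.
move=> + xk; elim/rho_from_ind => [|i h ki _ IH]; first exact: p1.
by rewrite pM IH p_rh; [rewrite /adj; repeat case: eqP; lia | lia].
Qed.

Lemma rho_from_bound k g x : rho_from k g -> (x <= m)%N -> (p g x <= m)%N.
Proof.
move=> + xm; elim/rho_from_ind => [|i h ki _ IH]; first by rewrite p1.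
by rewrite pM p_rh; [rewrite /adj; repeat case: eqP; lia | lia].
Qed.

(* Representatives of the left cosets of <rho_i, i > k> in <rho_i, i >= k>. *)
Fixpoint coset_rep (k d : nat) : G :=
  if d is d'.+1 then rh (k + d')%N * coset_rep k d' else 1.

Lemma rho_from_coset_rep k d : (k + d <= m)%N -> rho_from k (coset_rep k d).
Proof.
elim: d => [|d IH] kd; first exact: rho_from1.
by apply: rho_fromM; [apply: rho_from_rh | apply: IH]; lia.
Qed.

Lemma p_coset_rep k d : (k + d <= m)%N -> p (coset_rep k d) k = (k + d)%N.
Proof.
elim: d => [|d IH] kd /=; first by rewrite p1 addn0.
by rewrite pM IH ?p_rh; [rewrite /adj eqxx; lia | lia | lia].
Qed.

Lemma rh_coset_repC i k d : (k + d < i < m)%N ->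
  rh i * coset_rep k d = coset_rep k d * rh i.
Proof.
elim: d => [|d IH] kdi /=; first by rewrite mulg1 mul1g.
rewrite mulgA rhC ?/far; [|lia..].
by rewrite -!mulgA IH //; lia.
Qed.

(** [rh i] commutes with the letters above [i.+1], becomes [rh i.+1] by the braid relation, and then
    commutes with the remaining letters. *)
Lemma rh_coset_rep_shift i k d : (k <= i)%N -> (i.+1 < k + d <= m)%N ->
  rh i * coset_rep k d = coset_rep k d * rh i.+1.
Proof.
move=> ki; elim: d => [|d IH] kdi /=; first by lia.
case: (ltngtP i.+1 (k + d)%N) => [lt|gt|eq]; last 1 first.
- case: d eq {IH} kdi => [|d] eq kdi /=; first by lia.
  have -> : (k + d.+1 = i.+1)%N by lia.
  have -> : (k + d = i)%N by lia.
  rewrite !mulgA rh_braid; last by lia.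
  by rewrite -!mulgA rh_coset_repC //; lia.
- by rewrite mulgA rhC ?/far; [rewrite -!mulgA IH //; lia | lia..].
- by lia.
Qed.

(** The representative is lengthened if i = k + d, shortened if i + 1 = k + d, and otherwise kept,
    with [rh i] or [rh i.+1] emerging on its right. *)
Lemma rh_coset_rep i k d : (k <= i < m)%N -> (k + d <= m)%N ->
  exists d' u, [/\ (k + d' <= m)%N, rho_from k.+1 u
                 & rh i * coset_rep k d = coset_rep k d' * u].
Proof.
move=> kim kd; case: (ltngtP i (k + d)%N) => [lt|gt|eq]; first last.
- by exists d.+1, 1; rewrite eq mulg1; split=> //; [lia | exact: rho_from1].
- exists d, (rh i); split=> //; first by apply: rho_from_rh; lia.
  by apply: rh_coset_repC; lia.
have [eq|ne] := eqVneq i.+1 (k + d)%N; last first.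
  exists d, (rh i.+1); split=> //; first by apply: rho_from_rh; lia.
  by apply: rh_coset_rep_shift; lia.
case: d eq lt kd => [|d] eq lt kd /=; first by lia.
exists d, 1; have -> : (k + d = i)%N by lia.
by rewrite mulgA rhK ?mul1g ?mulg1; [split=> //; [lia | exact: rho_from1] | lia].
Qed.

Lemma rho_from_coset k g : (k <= m)%N -> rho_from k g ->
  exists d u, [/\ (k + d <= m)%N, rho_from k.+1 u & g = coset_rep k d * u].
Proof.
move=> km; elim/rho_from_ind => [|i h ki _ [d [u [kd ku ->]]]].
  by exists 0, 1; rewrite addn0 mulg1; split=> //; exact: rho_from1.
have [d' [v [kd' kv E]]] := rh_coset_rep ki kd.
by exists d', (v * u); rewrite mulgA E -mulgA; split=> //; exact: rho_fromM.
Qed.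

(** The representative sends [k] to k + d and its cofactor fixes [k], so d = 0. *)
Lemma rho_from_stab k g : (k <= m)%N -> rho_from k g -> p g k = k ->
  rho_from k.+1 g.
Proof.
move=> km /(rho_from_coset km)[d [u [kd ku ->]]].
rewrite pM (rho_from_fix ku) // p_coset_rep // => kdk.
have -> : d = 0%N by lia.
by rewrite /= mul1g.
Qed.

(** Fixing 0, ..., m in turn pushes [g] down the chain of stabilizers to [rho_from m.+1], where only
    the empty word is left. Thus the rho's generate a faithful copy of a symmetric group. *)
Lemma rho_trivial g : rho_from 0 g -> (forall x, (x <= m)%N -> p g x = x) -> g = 1.
Proof.
move=> g0 gx; have : rho_from m.+1 g.
  suff: forall k, (k <= m.+1)%N -> rho_from k g by apply.
  by elim=> // k IH km; apply: rho_from_stab; [lia | apply: IH; lia | exact: gx].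
by case=> -[|i w] //= /andP[]; lia.
Qed.

(** To add a last entry y, precompose with the representative moving [size s] to z = h^-1 y. It
    fixes all smaller points, and z >= [size s] because y is new. *)
Lemma rho_trans (s : seq nat) : uniq s -> all (fun x => x <= m)%N s ->
  exists2 h, rho_from 0 h & forall k, (k < size s)%N -> p h k = nth 0 s k.
Proof.
elim/last_ind: s => [|s y IH]; first by exists 1; [exact: rho_from1 |].
rewrite rcons_uniq all_rcons => /andP[ys us] /andP[ym sm].
have [h h0 hs] := IH us sm; pose z := p h^-1 y.
have zm : (z <= m)%N by exact: rho_from_bound (rho_fromV h0) ym.
have sz : (size s <= z)%N.
  rewrite leqNgt; apply: contra ys => zs.
  by rewrite -(pKV h y) -/z hs // mem_nth.
pose d := (z - size s)%N; have Ez : (size s + d = z)%N by rewrite subnKC.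
have cd : rho_from (size s) (coset_rep (size s) d).
  by apply: rho_from_coset_rep; rewrite Ez.
exists (h * coset_rep (size s) d) => [|k].
  by apply: rho_fromM => //; exact: rho_fromW cd.
rewrite size_rcons ltnS leq_eqVlt nth_rcons pM => /orP[/eqP->|ks].
  by rewrite p_coset_rep Ez // pKV ltnn eqxx.
by rewrite (rho_from_fix cd) // ks hs.
Qed.

Lemma rho_sg0C g : (0 < m)%N -> rho_from 2 g -> g * sg 0 = sg 0 * g.
Proof.
move=> m0; elim/rho_from_ind => [|i h i2 _ IH]; first by rewrite mul1g mulg1.
by rewrite -mulgA IH !mulgA sg_rhC // /far; lia.
Qed.

(* The generator x_(i,j) of the kernel of sigma_k |-> 1, rho_k |-> rho_k. *)
Definition is_arc (i j : nat) (x : G) : Prop :=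
  exists h, [/\ rho_from 0 h, p h 0 = i, p h 1 = j & x = h * sg 0 * h^-1].

(** Two choices of the conjugating element differ by an element fixing 0 and 1, hence lying in
    [rho_from 2], which commutes with [sg 0]. *)
Lemma arc_unique i j x y : (0 < m)%N -> is_arc i j x -> is_arc i j y -> x = y.
Proof.
move=> m0 [g [g0 gi gj ->]] [h [h0 hi hj ->]].
have u0 : rho_from 0 (g^-1 * h) by apply: rho_fromM => //; exact: rho_fromV.
have u2 : rho_from 2 (g^-1 * h).
  by apply: rho_from_stab => //; first apply: rho_from_stab => //;
    rewrite pM ?hi ?hj -?gi -?gj pVK.
have := rho_sg0C m0 u2 => /(congr1 (fun t => g * t * h^-1)).
by rewrite !mulgA mulgV mul1g mulgK => ->.
Qed.

Lemma arc_conj h i j x : rho_from 0 h -> is_arc i j x ->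
  is_arc (p h i) (p h j) (h * x * h^-1).
Proof.
move=> h0 [g [g0 <- <- ->]]; exists (h * g).
by rewrite !pM invgM !mulgA; split=> //; exact: rho_fromM.
Qed.

Lemma arc_exists i j : i != j -> (i <= m)%N -> (j <= m)%N -> exists x, is_arc i j x.
Proof.
move=> ij im jm; have [||h h0 hij] := @rho_trans [:: i; j].
- by rewrite /= inE ij.
- by rewrite /= im jm.
by exists (h * sg 0 * h^-1), h; split=> //; rewrite hij.
Qed.

(** By the mixed relation, rho_i rho_(i+1) conjugates sigma_i to sigma_(i+1), and it moves the pair
    (i, i+1) to (i+1, i+2). *)
Lemma arc_sg i : (i < m)%N -> is_arc i i.+1 (sg i).
Proof.
elim: i => [|i IH] im.
  by exists 1; rewrite !p1 invg1 mul1g mulg1; split=> //; exact: rho_from1.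
have h0 : rho_from 0 (rh i * rh i.+1) by apply: rho_fromM; apply: rho_from_rh; lia.
have Ei : p (rh i * rh i.+1) i = i.+1.
  by rewrite pM !p_rh ?(ltnW im) // /adj; repeat case: eqP; lia.
have Ei1 : p (rh i * rh i.+1) i.+1 = i.+2.
  by rewrite pM !p_rh ?(ltnW im) // /adj; repeat case: eqP; lia.
have := arc_conj h0 (IH (ltnW im)).
by rewrite Ei Ei1 rh_sg // -[sg i.+1 * _ * _]mulgA mulgK.
Qed.

(** * Relations among the conjugates x_(i,j) *)

Section Arcs.
Variable X : nat -> nat -> G.
Hypothesis m0 : (0 < m)%N.
Hypothesis XP : forall i j, i != j -> (i <= m)%N -> (j <= m)%N -> is_arc i j (X i j).

Lemma arcE i j x : i != j -> (i <= m)%N -> (j <= m)%N -> is_arc i j x -> X i j = x.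
Proof. by move=> ij im jm; apply: arc_unique => //; exact: XP. Qed.

Lemma arcJ h i j : rho_from 0 h -> i != j -> (i <= m)%N -> (j <= m)%N ->
  h * X i j * h^-1 = X (p h i) (p h j).
Proof.
move=> h0 ij im jm; apply/esym/arcE; last by apply: arc_conj => //; exact: XP.
- by apply: contra_neq ij => /(congr1 (p h^-1)); rewrite !pVK.
- exact: rho_from_bound h0 im.
- exact: rho_from_bound h0 jm.
Qed.

Lemma arc_sgE i : (i < m)%N -> X i i.+1 = sg i.
Proof. by move=> im; apply: arcE (arc_sg im); lia. Qed.

Lemma arcK i j : i != j -> (i <= m)%N -> (j <= m)%N -> X i j * X i j = 1.
Proof.
move=> ij im jm; have [h [_ _ _ ->]] := XP ij im jm.
by rewrite !mulgA mulgVK -(mulgA h) sgK // mulg1 mulgV.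
Qed.

Let conjM (h x y : G) : h * x * h^-1 * (h * y * h^-1) = h * (x * y) * h^-1.
Proof. by rewrite !mulgA mulgVK. Qed.

(** Conjugation by an [h] taking 0, 1, 2 to i, j, k reduces this to the braid relation of [sg 0] and
    [sg 1]. *)
Lemma arc_braid i j k : uniq [:: i; j; k] -> all (fun x => x <= m)%N [:: i; j; k] ->
  X i j * X j k * X i j = X j k * X i j * X j k.
Proof.
move=> us sm; have [h h0 hs] := rho_trans us sm.
have m2 : (1 < m)%N by move: us sm; rewrite /= !inE; lia.
have <- : h * sg 0 * h^-1 = X i j.
  by rewrite -arc_sgE // arcJ // !hs.
have <- : h * sg 1 * h^-1 = X j k.
  by rewrite -arc_sgE // arcJ ?(ltnW m2) // !hs.
by rewrite !conjM sg_braid.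
Qed.

(** The same transport, from the commuting pair [sg 0], [sg 2]. *)
Lemma arc_comm i j k l : uniq [:: i; j; k; l] ->
  all (fun x => x <= m)%N [:: i; j; k; l] -> X i j * X k l = X k l * X i j.
Proof.
move=> us sm; have [h h0 hs] := rho_trans us sm.
have m3 : (2 < m)%N by move: us sm; rewrite /= !inE; lia.
have <- : h * sg 0 * h^-1 = X i j.
  by rewrite -arc_sgE // arcJ // !hs.
have <- : h * sg 2 * h^-1 = X k l.
  by rewrite -arc_sgE // arcJ ?(ltnW m3) // !hs.
by rewrite !conjM sgC.
Qed.

End Arcs.

End Rho.

(** * The geometric action *)

Local Open Scope ring_scope.

(* For a <> b and k <> l, the negative of the off-diagonal Cartan entry of
   x_(a,b) and x_(k,l): 0, 1 and 2 encode the Coxeter exponents 2, 3 and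
   infinity.  Diagonal positions k = l are fixed by all reflections. *)
Definition arc_coef (T : eqType) (a b k l : T) : nat :=
  if k == l then 0%N
  else if [&& a != k, a != l, b != k & b != l] then 0%N
  else if (a == l) (+) (b == k) then 1%N else 2%N.

Definition arc_cartan (T : eqType) (a b k l : T) : rat :=
  if (a == k) && (b == l) then 2 else - (arc_coef a b k l)%:R.

Lemma arc_coef_sym (T : eqType) (a b k l : T) : a != b -> k != l ->
  arc_coef a b k l = arc_coef k l a b.
Proof.
move=> /negPf ab /negPf kl; rewrite /arc_coef ab kl ![k == _]eq_sym ![l == _]eq_sym.
by case: (a == k) (b == l) (b == k) (a == l) => [] [] [] [].
Qed.

Lemma arc_cartan_sym (T : eqType) (a b k l : T) : a != b -> k != l ->
  arc_cartan a b k l = arc_cartan k l a b.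
Proof.
move=> ab kl; rewrite /arc_cartan arc_coef_sym //.
by rewrite [k == a]eq_sym [l == b]eq_sym.
Qed.

Lemma arc_cartan_inj (T U : eqType) (f : T -> U) (a b k l : T) : injective f ->
  arc_cartan (f a) (f b) (f k) (f l) = arc_cartan a b k l.
Proof. by move=> fI; rewrite /arc_cartan /arc_coef !(inj_eq fI). Qed.

Section ArcReflections.
Variable n : nat.
Implicit Types (a b k l : 'I_n) (Y Z : 'M[rat]_n).

(** The pairing with the root [delta_mx a b], normalised so that a root pairs to 2 with itself. *)
Definition arc_form a b Y : rat :=
  \sum_(q : 'I_n * 'I_n) arc_cartan a b q.1 q.2 * Y q.1 q.2.

Definition arc_refl a b Y : 'M[rat]_n := Y - arc_form a b Y *: delta_mx a b.

(** A pullback, hence contravariant in [f]; for an involution it also moves positions forward by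
    [f]. *)
Definition mx_reindex (f : 'I_n -> 'I_n) Y : 'M[rat]_n := \matrix_(i, j) Y (f i) (f j).

Lemma arc_form_linear a b (x : rat) Y Z :
  arc_form a b (x *: Y + Z) = x * arc_form a b Y + arc_form a b Z.
Proof.
rewrite /arc_form big_distrr -big_split /=; apply: eq_bigr => q _.
by rewrite !mxE; ring.
Qed.

Lemma arc_form_delta a b k l : arc_form a b (delta_mx k l) = arc_cartan a b k l.
Proof.
rewrite /arc_form (bigD1 (k, l)) //= mxE !eqxx mulr1 big1 ?addr0 // => -[i j] /=.
rewrite xpair_eqE mxE /=; case: (i == k) => /=; case: (j == l) => //=;
  by rewrite mulr0.
Qed.

Lemma arc_refl_delta a b k l :
  arc_refl a b (delta_mx k l) = delta_mx k l - arc_cartan a b k l *: delta_mx a b.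
Proof. by rewrite /arc_refl arc_form_delta. Qed.

Lemma arc_form_refl a b k l Y :
  arc_form k l (arc_refl a b Y) = arc_form k l Y - arc_form a b Y * arc_cartan k l a b.
Proof.
by rewrite /arc_refl addrC -scaleNr arc_form_linear arc_form_delta; ring.
Qed.

Lemma arc_refl_linear a b (x : rat) Y Z :
  arc_refl a b (x *: Y + Z) = x *: arc_refl a b Y + arc_refl a b Z.
Proof.
by rewrite /arc_refl arc_form_linear; apply/matrixP => i j; rewrite !mxE; ring.
Qed.

Lemma arc_reflK a b : involutive (arc_refl a b).
Proof.
move=> Y; rewrite {1}/arc_refl arc_form_refl {1}/arc_cartan !eqxx /=.
by apply/matrixP => i j; rewrite !mxE; ring.
Qed.

Lemma arc_refl_comm a b k l : arc_cartan a b k l = 0 -> arc_cartan k l a b = 0 ->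
  arc_refl a b \o arc_refl k l =1 arc_refl k l \o arc_refl a b.
Proof.
move=> E E' Y /=; rewrite {1 3}/arc_refl !arc_form_refl E E'.
by apply/matrixP => i j; rewrite !mxE; ring.
Qed.

Lemma arc_refl_braid a b k l : arc_cartan a b k l = -1 -> arc_cartan k l a b = -1 ->
  arc_refl a b \o arc_refl k l \o arc_refl a b =1
  arc_refl k l \o arc_refl a b \o arc_refl k l.
Proof.
have c2 x y : arc_cartan x y x y = 2 :> rat by rewrite /arc_cartan !eqxx.
move=> E E' Y /=; rewrite {1 4}/arc_refl !arc_form_refl E E' !c2.
rewrite /arc_refl !arc_form_refl.
by apply/matrixP => i j; rewrite !mxE -/(arc_form _ _ _) E E'; ring.
Qed.

Lemma mx_reindex_linear f (x : rat) Y Z :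
  mx_reindex f (x *: Y + Z) = x *: mx_reindex f Y + mx_reindex f Z.
Proof. by apply/matrixP => i j; rewrite !mxE. Qed.

Lemma mx_reindexK f : involutive f -> involutive (mx_reindex f).
Proof. by move=> fK Y; apply/matrixP => i j; rewrite !mxE !fK. Qed.

Lemma mx_reindex_comp f g Y : mx_reindex f (mx_reindex g Y) = mx_reindex (g \o f) Y.
Proof. by apply/matrixP => i j; rewrite !mxE. Qed.

Lemma mx_reindex_delta f a b : involutive f ->
  mx_reindex f (delta_mx a b) = delta_mx (f a) (f b).
Proof. by move=> fK; apply/matrixP => i j; rewrite !mxE !(inv_eq fK). Qed.

(** Cartan entries depend only on coincidences between indices, so relabelling carries reflections
    to reflections. *)
Lemma mx_reindex_refl f a b Y : involutive f ->
  mx_reindex f (arc_refl a b Y) = arc_refl (f a) (f b) (mx_reindex f Y).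
Proof.
move=> fK; rewrite /arc_refl addrC -scaleNr mx_reindex_linear mx_reindex_delta //.
rewrite scaleNr addrC; congr (_ - _ *: _); rewrite /arc_form.
pose F (q : 'I_n * 'I_n) := (f q.1, f q.2).
have FK : involutive F by case=> i j; rewrite /F /= !fK.
rewrite (reindex_inj (inv_inj FK)) /=; apply: eq_bigr => q _.
by rewrite mxE -(arc_cartan_inj _ _ _ _ (inv_inj fK)) !fK.
Qed.

End ArcReflections.

Local Open Scope group_scope.

Lemma arc_cartan_next i : arc_cartan i i.+1 i.+1 i.+2 = (-1)%R.
Proof. by rewrite /arc_cartan /arc_coef; repeat (case: eqP => ? //=); exfalso; lia. Qed.

Lemma arc_cartan_far i j : far i j -> arc_cartan i i.+1 j j.+1 = 0%R.
Proof.
rewrite /far /arc_cartan /arc_coef => ij.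
by repeat (case: eqP => ? //=); rewrite ?oppr0 //; exfalso; lia.
Qed.

Lemma adj_far i j : far i j -> adj j i = i /\ adj j i.+1 = i.+1.
Proof. by rewrite /far /adj => ij; split; repeat case: eqP; lia. Qed.

(** * The parity, permutation and matrix actions of $FVB_{m+1}$ *)

Section IndexedGenerators.
Variable m : nat.
Notation G := (FVB m.+1).
Notation V := 'M[rat]_m.+1.

(* Extended by the junk value 1 for i >= m. *)
Definition sigma_nat (i : nat) : G := oapp (@fvb_sigma m.+1) 1 (insub i : option 'I_m).
Definition rho_nat (i : nat) : G := oapp (@fvb_rho m.+1) 1 (insub i : option 'I_m).

Lemma sigma_natE (i : 'I_m) : sigma_nat i = @fvb_sigma m.+1 i.
Proof. by rewrite /sigma_nat valK. Qed.

Lemma rho_natE (i : 'I_m) : rho_nat i = @fvb_rho m.+1 i.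
Proof. by rewrite /rho_nat valK. Qed.

Let lift_ord (Q : nat -> Prop) : (forall i : 'I_m, Q i) -> forall i, (i < m)%N -> Q i.
Proof. by move=> H i im; exact: (H (Ordinal im)). Qed.

Let lift_ord2 (Q : nat -> nat -> Prop) : (forall i j : 'I_m, Q i j) ->
  forall i j, (i < m)%N -> (j < m)%N -> Q i j.
Proof. by move=> H i j im jm; exact: (H (Ordinal im) (Ordinal jm)). Qed.

Lemma rho_natK i : (i < m)%N -> rho_nat i * rho_nat i = 1.
Proof. by move: i; apply: lift_ord => i; rewrite rho_natE fvb_rhoK. Qed.

Lemma sigma_natK i : (i < m)%N -> sigma_nat i * sigma_nat i = 1.
Proof. by move: i; apply: lift_ord => i; rewrite sigma_natE fvb_sigmaK. Qed.

Lemma rho_nat_braid i : (i.+1 < m)%N ->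
  rho_nat i * rho_nat i.+1 * rho_nat i = rho_nat i.+1 * rho_nat i * rho_nat i.+1.
Proof.
move=> im; have := @fvb_rho_braid m.+1 (Ordinal (ltnW im)) (Ordinal im) erefl.
by rewrite -!rho_natE.
Qed.

Lemma sigma_nat_braid i : (i.+1 < m)%N ->
  sigma_nat i * sigma_nat i.+1 * sigma_nat i =
  sigma_nat i.+1 * sigma_nat i * sigma_nat i.+1.
Proof.
move=> im; have := @fvb_sigma_braid m.+1 (Ordinal (ltnW im)) (Ordinal im) erefl.
by rewrite -!sigma_natE.
Qed.

Lemma rho_sigma_nat i : (i.+1 < m)%N ->
  rho_nat i * rho_nat i.+1 * sigma_nat i = sigma_nat i.+1 * rho_nat i * rho_nat i.+1.
Proof.
move=> im; have := @fvb_mixed m.+1 (Ordinal (ltnW im)) (Ordinal im) erefl.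
by rewrite -!sigma_natE -!rho_natE.
Qed.

Lemma rho_natC i j : (i < m)%N -> (j < m)%N -> far i j ->
  rho_nat i * rho_nat j = rho_nat j * rho_nat i.
Proof.
by move: i j; apply: lift_ord2 => i j ij; rewrite !rho_natE fvb_rhoC.
Qed.

Lemma sigma_natC i j : (i < m)%N -> (j < m)%N -> far i j ->
  sigma_nat i * sigma_nat j = sigma_nat j * sigma_nat i.
Proof.
by move: i j; apply: lift_ord2 => i j ij; rewrite !sigma_natE fvb_sigmaC.
Qed.

Lemma sigma_rho_natC i j : (i < m)%N -> (j < m)%N -> far i j ->
  sigma_nat i * rho_nat j = rho_nat j * sigma_nat i.
Proof.
by move: i j; apply: lift_ord2 => i j ij; rewrite sigma_natE rho_natE fvb_sigma_rhoC.
Qed.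

Lemma fvb_nat_ind (Q : G -> Prop) : Q 1 ->
  (forall i g, (i < m)%N -> Q g -> Q (sigma_nat i * g)) ->
  (forall i g, (i < m)%N -> Q g -> Q (rho_nat i * g)) -> forall g, Q g.
Proof.
move=> Q1 Qs Qr g; have [w ->] := fvb_generated g.
elim: w => [|[i|i] w IH] //=.
  by rewrite -sigma_natE; apply: Qs => //; exact: ltn_ord.
by rewrite -rho_natE; apply: Qr => //; exact: ltn_ord.
Qed.

(** The two sides of each relation contain numbers of sigma's of the same parity. *)
Lemma parity_action : exists act : G -> bool -> bool,
  [/\ is_action act, forall i, (i < m)%N -> act (sigma_nat i) =1 negb
    & forall i, (i < m)%N -> act (rho_nat i) =1 id].
Proof.
have [//|//|//|//|//|//|//|//|act [aP aS aR]] :=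
  @fvb_action m.+1 bool (fun=> negb) (fun=> id).
- by move=> i; exact: negbK.
- exists act; split=> //; apply: lift_ord => i b.
    by rewrite sigma_natE aS.
  by rewrite rho_natE aR.
Qed.

(** Setting every sigma to 1 leaves the relations of the symmetric group; this action moves the
    indices of the x_(i,j). *)
Lemma adj_action : exists act : G -> nat -> nat,
  [/\ is_action act, forall i, (i < m)%N -> act (sigma_nat i) =1 id
    & forall i, (i < m)%N -> act (rho_nat i) =1 adj i].
Proof.
have [||||||||act [aP aS aR]] :=
  @fvb_action m.+1 nat (fun=> id) (fun i => adj i) => //.
- by move=> i; exact: adjK.
- by move=> i j -> x; exact: adj_braid.
- by move=> i j /adjC.
- exists act; split=> //; apply: lift_ord => i x.
    by rewrite sigma_natE aS.
  by rewrite rho_natE aR.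
Qed.

Definition adj_ord (i : nat) (a : 'I_m.+1) : 'I_m.+1 := inord (adj i a).

Lemma val_adj_ord i a : (i < m)%N -> adj_ord i a = adj i a :> nat.
Proof.
move=> im; rewrite inordK //; have := ltn_ord a; rewrite /adj.
by repeat case: eqP; lia.
Qed.

Lemma adj_ordK i : (i < m)%N -> involutive (adj_ord i).
Proof. by move=> im a; apply: val_inj; rewrite /= !val_adj_ord // adjK. Qed.

Lemma adj_ord_inord i x : (i < m)%N -> (x <= m)%N -> adj_ord i (inord x) = inord (adj i x).
Proof. by move=> im xm; rewrite /adj_ord inordK. Qed.

Lemma inord_neq i : (i < m)%N -> (inord i : 'I_m.+1) != inord i.+1.
Proof. by move=> im; apply/eqP => /(congr1 val); rewrite /= !inordK; lia. Qed.

Lemma adj_ord_next i : (i.+1 < m)%N ->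
  adj_ord i (adj_ord i.+1 (inord i)) = inord i.+1 /\
  adj_ord i (adj_ord i.+1 (inord i.+1)) = inord i.+2.
Proof.
move=> im; have im' := ltnW im.
have Ei : adj i.+1 i = i by rewrite /adj; repeat case: eqP; lia.
have Ei1 : adj i.+1 i.+1 = i.+2 by rewrite /adj eqxx.
rewrite !adj_ord_inord ?Ei ?Ei1 ?(ltnW im') //.
by split; congr inord; rewrite /adj; repeat case: eqP; lia.
Qed.

(** Relations among sigma's follow from Cartan entries -1 and 0, those among rho's from identities
    of transpositions, and those mixing the two from the equivariance of reflections. *)
Lemma geometric_action : exists act : G -> V -> V,
  [/\ is_action act,
      forall i, (i < m)%N -> act (sigma_nat i) =1 arc_refl (inord i) (inord i.+1)
    & forall i, (i < m)%N -> act (rho_nat i) =1 mx_reindex (adj_ord i)].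
Proof.
have cart a b k l : (a <= m)%N -> (b <= m)%N -> (k <= m)%N -> (l <= m)%N ->
    arc_cartan (inord a : 'I_m.+1) (inord b : 'I_m.+1) (inord k) (inord l)
    = arc_cartan a b k l.
  move=> am bm km lm; rewrite -(arc_cartan_inj _ _ _ _ (@ord_inj m.+1)).
  by rewrite !inordK.
have [||||||||act [aP aS aR]] := @fvb_action m.+1 V
  (fun i => arc_refl (inord i) (inord i.+1)) (fun i => mx_reindex (adj_ord i)).
- by move=> i; exact: arc_reflK.
- by move=> i; apply/mx_reindexK/adj_ordK; exact: ltn_ord.
- move=> i j ij; have jm : (j < m)%N := ltn_ord j; rewrite ij in jm *.
  have E := cart i i.+1 i.+1 i.+2; rewrite arc_cartan_next in E.
  apply: arc_refl_braid; first by apply: E; lia.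
  by rewrite arc_cartan_sym ?inord_neq // ?(ltnW jm) //; apply: E; lia.
- move=> i j ij; have im : (i < m)%N := ltn_ord i; have jm : (j < m)%N := ltn_ord j.
  have E := cart i i.+1 j j.+1; rewrite arc_cartan_far // in E.
  apply: arc_refl_comm; first by apply: E; lia.
  by rewrite arc_cartan_sym ?inord_neq //; apply: E; lia.
- move=> i j ij Y /=; have jm : (j < m)%N := ltn_ord j.
  rewrite !mx_reindex_comp; congr mx_reindex; apply/funext => a; apply: val_inj.
  by rewrite /= !val_adj_ord // ij; [exact: adj_braid | lia..].
- move=> i j ij Y /=; rewrite !mx_reindex_comp; congr mx_reindex.
  apply/funext => a; apply: val_inj.
  by rewrite /= !val_adj_ord ?ltn_ord //; exact/esym/(adjC ij).
- move=> i j ij Y /=; have im : (i < m)%N := ltn_ord i.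
  have jm : (j < m)%N := ltn_ord j.
  rewrite mx_reindex_refl; last exact: adj_ordK.
  rewrite !adj_ord_inord ?(ltnW im) //.
  by have [-> ->] := adj_far ij.
- move=> i j ij Y /=; have jm : (j < m)%N := ltn_ord j.
  have im : (i < m)%N := ltn_ord i.
  rewrite !mx_reindex_refl; [|exact: adj_ordK..].
  by rewrite ij in jm *; have [-> ->] := adj_ord_next jm.
- exists act; split=> //; apply: lift_ord => i x.
    by rewrite sigma_natE aS.
  by rewrite rho_natE aR.
Qed.

End IndexedGenerators.

(** * From linear actions to matrix representations *)

Lemma linear_group_of_action (G : groupType) (F : fieldType) (n : nat)
    (act : G -> 'M[F]_n -> 'M[F]_n) :
  is_action act ->
  (forall g (x : F) Y Z, act g (x *: Y + Z)%R = (x *: act g Y + act g Z)%R) ->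
  (forall g, act g =1 id -> g = 1) -> linear_group G.
Proof.
move=> [act1 actM] actL faithful.
pose L g : {linear 'M[F]_n -> 'M[F]_n} := HB.pack (act g)
  (GRing.isLinear.Build F 'M[F]_n 'M[F]_n *:%R (act g) (actL g)).
(* Matrices act on row vectors, on the right; the inverse restores the order. *)
pose r g := lin_mx (L g^-1).
have rE g Y : (mxvec Y *m r g)%R = mxvec (act g^-1 Y) by rewrite mul_vec_lin.
exists F, (n * n)%N, r; split; first split.
- apply/row_matrixP => i; rewrite !rowE mulmx1 -[delta_mx _ _]vec_mxK rE.
  by rewrite invg1 act1.
- move=> x y; apply/row_matrixP => i; rewrite !rowE -[delta_mx _ _]vec_mxK.
  by rewrite mulmxA !rE invgM actM.
move=> x y rxy; apply: (mulIg y^-1); rewrite mulgV; apply: faithful => Y.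
have E : act x^-1 Y = act y^-1 Y by apply: (can_inj mxvecK); rewrite -!rE rxy.
by rewrite actM -E -actM mulgV act1.
Qed.

(** * Faithfulness of the geometric action *)

Section Faithful.
Variable m : nat.
Hypothesis m0 : (0 < m)%N.
Notation G := (FVB m.+1).
Notation V := 'M[rat]_m.+1.
Notation rho_sub := (rho_from m (@rho_nat m) 0).
Notation arc := {q : 'I_m.+1 * 'I_m.+1 | q.1 != q.2}.

Theorem fvb_geometric_faithful : exists act : G -> V -> V,
  [/\ is_action act,
      forall g (x : rat) Y Z, act g (x *: Y + Z)%R = (x *: act g Y + act g Z)%R
    & forall g, act g =1 id -> g = 1].
Proof.
have [act [actP act_s act_r]] := geometric_action m.
have [p [pP p_s p_r]] := adj_action m.
have [b [bP b_s b_r]] := parity_action m.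
have [[act1 actM] [p1 pM]] := (actP, pP); have [b1 bM] := bP.
have actL g (x : rat) Y Z : act g (x *: Y + Z)%R = (x *: act g Y + act g Z)%R.
  elim/fvb_nat_ind: g Y Z => [|i g im IH|i g im IH] Y Z; first by rewrite !act1.
    by rewrite !actM IH !act_s // arc_refl_linear.
  by rewrite !actM IH !act_r // mx_reindex_linear.
exists act; split=> //.
pose isarc := is_arc m (@sigma_nat m) (@rho_nat m) p.
(* One x_(i,j) is chosen for each valid pair; the value 1 at other pairs is a dummy. *)
have [X XP] : exists X : nat -> nat -> G, forall i j,
    i != j -> (i <= m)%N -> (j <= m)%N -> isarc i j (X i j).
  have ex (q : nat * nat) : exists x, q.1 != q.2 -> (q.1 <= m)%N -> (q.2 <= m)%N ->
      isarc q.1 q.2 x.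
    have [/and3P[q12 q1m q2m]|nq] := boolP [&& q.1 != q.2, q.1 <= m & q.2 <= m]%N.
      have [x Xx] := arc_exists (@sigma_nat m) (@rho_natK m) pP p_r q12 q1m q2m.
      by exists x.
    by exists 1 => q12 q1m q2m; rewrite q12 q1m q2m in nq.
  by have [f fP] := choice ex; exists (fun i j => f (i, j)) => i j; exact: (fP (i, j)).
have XJ := arcJ (@rho_natK m) (@rho_nat_braid m) (@rho_natC m) (@sigma_rho_natC m)
  pP p_r m0 XP.
have XsgE := arc_sgE (@rho_natK m) (@rho_nat_braid m) (@rho_natC m)
  (@sigma_rho_natC m) (@rho_sigma_nat m) pP p_r m0 XP.
have Xbraid := arc_braid (@rho_natK m) (@rho_nat_braid m) (@rho_natC m)
  (@sigma_nat_braid m) (@sigma_rho_natC m) (@rho_sigma_nat m) pP p_r m0 XP.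
have Xcomm := arc_comm (@rho_natK m) (@rho_nat_braid m) (@rho_natC m)
  (@sigma_natC m) (@sigma_rho_natC m) (@rho_sigma_nat m) pP p_r m0 XP.
pose x_ (q : arc) : G := X (val q).1 (val q).2.
have pbound h (a : nat) : rho_sub h -> (a <= m)%N -> (p h a <= m)%N.
  by move=> h0 am; exact: (rho_from_bound pP p_r h0).
have bnd (i : 'I_m.+1) : (i <= m)%N by rewrite -ltnS.
pose po h (a : 'I_m.+1) : 'I_m.+1 := inord (p h a).
have val_po h a : rho_sub h -> po h a = p h a :> nat.
  by move=> h0; rewrite inordK // ltnS; apply: pbound => //; rewrite -ltnS ltn_ord.
have po_rh i h a : (i < m)%N -> rho_sub h -> adj_ord i (po h a) = po (rho_nat m i * h) a.
  by move=> im h0; rewrite /po adj_ord_inord ?pM ?p_r // pbound // -ltnS ltn_ord.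
have po1 a : po 1 a = a by rewrite /po p1 inord_val.
have act_delta h c d : rho_sub h ->
    act h (delta_mx c d) = delta_mx (po h c) (po h d).
  move: h; apply: rho_from_ind => [|i h im h0 IH]; first by rewrite act1 !po1.
  by rewrite actM IH act_r // mx_reindex_delta ?po_rh //; exact: adj_ordK.
have act_refl h c d Y : rho_sub h ->
    act h (arc_refl c d Y) = arc_refl (po h c) (po h d) (act h Y).
  move: h; apply: rho_from_ind => [|i h im h0 IH]; first by rewrite !act1 !po1.
  by rewrite !actM IH !act_r // mx_reindex_refl ?po_rh //; exact: adj_ordK.
have actVK h Y : act h (act h^-1 Y) = Y by rewrite -actM mulgV act1.
(* x_q is a conjugate of [sigma_nat 0] by an [h] taking the position (0,1) to q, so it acts as the
   reflection at q. *)
have act_x q Y : act (x_ q) Y = arc_refl (val q).1 (val q).2 Y.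
  have [h [h0 hi hj Xh]] := XP _ _ (valP q) (ltn_ord (val q).1) (ltn_ord (val q).2).
  rewrite /x_ Xh !actM act_s // act_refl // actVK.
  by congr arc_refl; apply: val_inj; rewrite /= val_po // inordK.
have b_rho h y : rho_sub h -> b h y = y.
  move=> h0; move: h h0 y; apply: rho_from_ind => [|i h im h0 IH] y; first by rewrite b1.
  by rewrite bM b_r.
have b_x q : b (x_ q) =1 negb.
  move=> y; have [h [h0 _ _]] := XP _ _ (valP q) (ltn_ord (val q).1) (ltn_ord (val q).2).
  by rewrite /x_ => ->; rewrite !bM b_rho // b_s // b_rho //; exact: (rho_fromV (@rho_natK m)).
have parity u v : gprod x_ u = gprod x_ v -> odd (size u) = odd (size v).
  have bw w y : b (gprod x_ w) y = odd (size w) (+) y.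
    by elim: w => [|q w IH] /=; rewrite ?b1 // bM b_x IH addNb.
  by move=> /(congr1 (b^~ false)); rewrite !bw !addbF.
(* $FVB_n$ is the product of W and the rho subgroup: a sigma on the left is a new letter x_q, and a
   rho passes through the word by permuting its indices. *)
have decomp g : exists w h, rho_sub h /\ g = gprod x_ w * h.
  have arcP i j : i != j -> (i <= m)%N -> (j <= m)%N -> exists q, X i j = x_ q.
    move=> ij im jm; have neq : (inord i : 'I_m.+1) != inord j.
      by apply: contra_neq ij => /(congr1 val); rewrite /= !inordK.
    by exists (Sub (inord i, inord j) neq); rewrite /x_ /= !inordK.
  elim/fvb_nat_ind: g => [|i g im [w [h [h0 ->]]]|i g im [w [h [h0 ->]]]].
  - by exists [::], 1; split; [exact: rho_from1 | rewrite mulg1].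
  - have [||q Eq] := arcP i i.+1 _ _ im; [lia | exact: ltnW |].
    by exists (q :: w), h; split=> //; rewrite /= -Eq XsgE // mulgA.
  have r0 : rho_sub (rho_nat m i) by exact: rho_from_rh.
  suff [w' Ew] : exists w', rho_nat m i * gprod x_ w = gprod x_ w' * rho_nat m i.
    exists w', (rho_nat m i * h); split; first exact: rho_fromM.
    by rewrite !mulgA Ew.
  elim: w => [|q w [w' IH]] /=; first by exists [::]; rewrite mul1g mulg1.
  have [|||q' Eq'] := arcP (p (rho_nat m i) (val q).1) (p (rho_nat m i) (val q).2).
  + by apply: contra_neq (valP q) => /(congr1 (p (rho_nat m i)^-1));
      rewrite -!pM mulVg !p1 => /val_inj.
  + exact: pbound (bnd _).
  + exact: pbound (bnd _).
  have XJq : rho_nat m i * x_ q * (rho_nat m i)^-1 = x_ q'.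
    by rewrite -Eq'; apply: XJ; [|exact: (valP q)|exact: bnd|exact: bnd].
  by exists (q' :: w'); rewrite /= -XJq -mulgA -IH !mulgA mulgVK.
move=> g gid; have [w [h [h0 Eg]]] := decomp g.
have fix_diag u (a : 'I_m.+1) : act (gprod x_ u) (delta_mx a a) = delta_mx a a.
  elim: u => [|q u IH] /=; first by rewrite act1.
  rewrite actM IH act_x arc_refl_delta /arc_cartan /arc_coef eqxx.
  case: andP => [[/eqP E1 /eqP E2]|_]; last by rewrite oppr0 scale0r subr0.
  by have := valP q; rewrite /= E1 E2 eqxx.
(* As W fixes diagonal positions, the trivial action of [g] forces [h] to fix every index. *)
have h1 : h = 1.
  apply: (rho_trivial (@rho_natK m) (@rho_nat_braid m) (@rho_natC m) pP p_r h0).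
  move=> a am; have := gid (delta_mx (inord a) (inord a)).
  rewrite Eg actM act_delta // fix_diag => /matrixP/(_ (inord a) (inord a)).
  rewrite !mxE !eqxx /= andbb; case: eqP => [+ _|_ /eqP]; last by rewrite eq_sym oner_eq0.
  by move=> /(congr1 val); rewrite /= val_po // inordK.
rewrite Eg h1 mulg1.
pose alpha (q : arc) : V := delta_mx (val q).1 (val q).2.
pose nonneg (Y : V) := forall i j, (0 <= Y i j)%R.
apply: (@tits_faithful G arc x_
  (fun q r => arc_coef (val q).1 (val q).2 (val r).1 (val r).2) _ _ _ _ _
  V act alpha nonneg) => //.
- move=> q; apply: (arcK (@sigma_natK m) m0 XP); [exact: (valP q)|exact: bnd..].
- by move=> q r; exact: (arc_coef_sym (valP q) (valP r)).
(* Coefficient 0 at two off-diagonal positions means four distinct indices. *)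
- move=> q r _; rewrite /arc_coef (negPf (valP r)).
  case: ifP => [/and4P[n1 n2 n3 n4] _|_]; last by case: ifP.
  apply: Xcomm; last by rewrite /= !bnd.
  by rewrite /= !inE !negb_or n1 n2 n3 n4 (valP q) (valP r).
(* Coefficient 1 means that the two pairs are consecutive, in one of the two orders, with three
   distinct indices. *)
- move=> q r _; rewrite /arc_coef (negPf (valP r)); case: ifP => // _; case: ifP => // E _.
  have := valP r; have := valP q; rewrite /x_.
  case: (val q) (val r) E => [a c] [k l] /= + ac.
  case: (eqVneq a l) => [<-|al] /= => [ck ka|/eqP <- cl].
    by apply/esym/Xbraid; rewrite /= ?bnd // !inE negb_or ka eq_sym ck ac.
  by apply: Xbraid; rewrite /= ?bnd // !inE negb_or ac al cl.
- move=> g' Y Z; have := actL g' 1%R Y Z; by rewrite !scale1r.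
- move=> q; rewrite act_x arc_refl_delta /arc_cartan !eqxx.
  by apply/matrixP => i j; rewrite !mxE; ring.
- move=> q r qr; rewrite act_x arc_refl_delta /arc_cartan.
  case: andP => [[/eqP E1 /eqP E2]|_]; last by rewrite scaleNr opprK scaler_nat.
  by case/eqP: qr; apply: val_inj; case: (val q) (val r) E1 E2 => [? ?] [? ?] /= -> ->.
- by move=> i j; rewrite mxE.
- by move=> Y Z HY HZ i j; rewrite mxE addr_ge0.
- by move=> q i j; rewrite mxE ler0n.
- by move=> q /(_ (val q).1 (val q).2); rewrite !mxE !eqxx oppr_ge0 ler10.
- by move=> Y; rewrite -[RHS]gid Eg h1 mulg1.
Qed.

End Faithful.

Lemma fvb1_trivial (g : FVB 1) : g = 1.
Proof. by have [[|[i|i] w] ->] := fvb_generated g; first by []; case: i. Qed.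

Theorem corollary5p4 (n : nat) (hn : (0 < n)%N) : linear_group (FVB n).
Proof.
case: n hn => // -[|m] _; last first.
  have [act [actP actL faithful]] := @fvb_geometric_faithful m.+1 isT.
  exact: linear_group_of_action actP actL faithful.
(* $FVB_1$ has no generators, so its representation of dimension 0 is faithful. *)
exists rat, 0%N, (fun=> 1%:M%R); split=> [|x y _].
  by split=> // x y; rewrite mulmx1.
by rewrite (fvb1_trivial x) (fvb1_trivial y).
Qed.
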